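(* Let $K$ be a field. The Lie ideals of $\mathscr T_K^-$ are precisely the following: (i) $0$ and $K1$; (ii) $\mathfrak s+U$, where $U$ is a $K$-subspace of $P_K\oplus Kw$ with $w\notin U$; (iii) $\rho^{-1}(W)$, where $W$ is a $K$-subspace of $K[t,t^{-1}]$.
   Context: Let $K$ be a field. The algebraic Toeplitz algebra $\mathscr T_K$ is the Leavitt path algebra over $K$ of the graph with two vertices $v,w$ and two edges, $e$ from $v$ to $v$ and $f$ from $v$ to $w$. Concretely, it is the associative unital $K$-algebra generated by $v,w,e,f,e^*,f^*$ subject to: $1=v+w$; $v^2=v$, $w^2=w$, $vw=wv=0$; $ve=ev=e$, $vf=fw=f$, $ve^*=e^*v=e^*$, $wf^*=f^*v=f^*$; $e^*e=v$, $f^*f=w$, $e^*f=f^*e=0$; $v=ee^*+ff^*$. For an associative algebra $A$, $A^-$ is the Lie algebra on the same vector space with bracket $[a,b]=ab-ba$. A Lie ideal of $A^-$ is a $K$-subspace $L$ with $[a,x]\in L$ for all $a\in A$, $x\in L$. For subspaces $B,C$, $[B,C]$ denotes the $K$-span of all $[b,c]$ with $b\in B$, $c\in C$. $F=I(w)$ is the two-sided ideal of $\mathscr T_K$ generated by $w$, and $\mathfrak s=[F,F]$. $\rho:\mathscr T_K\to K[t,t^{-1}]$ is the $K$-algebra homomorphism with $\rho(v)=1$, $\rho(e)=t$, $\rho(e^* )=t^{-1}$, $\rho(w)=\rho(f)=\rho(f^* )=0$. $P_K=K1$ if $\operatorname{char}K=0$, and $P_K=\operatorname{span}_K\{1,e^{m\ell},(e^*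 )^{m\ell}:m\geq1\}$ if $\operatorname{char}K=\ell>0$. The sum $P_K+Kw$ inside $\mathscr T_K$ is direct. *)

(* Defs.v *)
From HB Require Import structures.
From mathcomp Require Import all_boot all_order all_algebra.
From mathcomp Require Import boolp classical_sets.
From mathcomp.multinomials Require Import monalg.

Set Implicit Arguments.
Unset Strict Implicit.
Unset Printing Implicit Defensive.

Import GRing.Theory.

Local Open Scope classical_set_scope.
Local Open Scope ring_scope.
Local Open Scope quotient_scope.

Section Subspaces.
Context {K : fieldType}.

Definition is_subspace {V : lmodType K} (S : set V) : Prop :=
  GRing.submod_closed (mem S).

Lemma is_subspaceP (V : lmodType K) (S : set V) :
  is_subspace S <->
  S 0 /\ (forall (a : K) (x y : V), S x -> S y -> S (a *: x + y)).
Proof.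
split=> -[S0 SD]; split.
- by apply/set_mem.
- by move=> a x y Sx Sy; apply/set_mem/SD; apply/mem_set.
- by apply/mem_set.
- by move=> a x y /set_mem Sx /set_mem Sy; apply/mem_set/SD.
Qed.

Definition lspan {V : lmodType K} (S : set V) : set V := smallest is_subspace S.

Definition sum_set {V : lmodType K} (S T : set V) : set V :=
  [set x + y | x in S & y in T].

Definition is_ideal {A : lalgType K} (I : set A) : Prop :=
  is_subspace I /\ (forall a x : A, I x -> I (a * x) /\ I (x * a)).

Definition ideal_gen {A : lalgType K} (S : set A) : set A := smallest is_ideal S.

Definition bracket {A : lalgType K} (a b : A) : A := a * b - b * a.

Definition bracket_set {A : lalgType K} (B C : set A) : set A :=
  lspan [set bracket b c | b in B & c in C].

Definition is_lie_ideal {A : lalgType K} (L : set A) : Prop :=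
  is_subspace L /\ (forall a x : A, L x -> L (bracket a x)).

Lemma ideal_gen_is_ideal (A : lalgType K) (S : set A) : is_ideal (ideal_gen S).
Proof.
split; [apply/is_subspaceP; split|].
- by move=> I [[/is_subspaceP[]]].
- move=> a x y Ix Iy I HI; have [/is_subspaceP[_ ID] _] := HI.1.
  by apply: ID; [exact: Ix|exact: Iy].
- move=> a x Ix; split=> I HI; have [_ IM] := HI.1.
    exact: (IM a x (Ix _ HI)).1.
  exact: (IM a x (Ix _ HI)).2.
Qed.

End Subspaces.

Local Notation "x %:F" := (@FracField.tofrac _ x).

(* The field K(t), with its K-algebra structure. *)
Definition ratfun (K : fieldType) := {fraction {poly K}}.

Section RatFun.
Variable K : fieldType.
Implicit Types (a b : K) (x y : ratfun K).

HB.instance Definition _ := GRing.Field.on (ratfun K).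

Definition ratfun_scale a x : ratfun K := (a%:P)%:F * x.

Fact ratfun_scaleA a b x :
  ratfun_scale a (ratfun_scale b x) = ratfun_scale (a * b) x.
Proof. by rewrite /ratfun_scale mulrA -!rmorphM. Qed.

Fact ratfun_scale1 : left_id 1 ratfun_scale.
Proof. by move=> x; rewrite /ratfun_scale !rmorph1 mul1r. Qed.

Fact ratfun_scaleDr : right_distributive ratfun_scale +%R.
Proof. by move=> a x y; rewrite /ratfun_scale mulrDr. Qed.

Fact ratfun_scaleDl x : {morph ratfun_scale^~ x : a b / a + b}.
Proof. by move=> a b; rewrite /ratfun_scale !rmorphD mulrDl. Qed.

HB.instance Definition _ := GRing.Zmodule_isLmodule.Build K (ratfun K)
  ratfun_scaleA ratfun_scale1 ratfun_scaleDr ratfun_scaleDl.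

Fact ratfun_scaleAl a x y : a *: (x * y) = (a *: x) * y.
Proof. exact: mulrA. Qed.

HB.instance Definition _ :=
  GRing.Lmodule_isLalgebra.Build K (ratfun K) ratfun_scaleAl.
HB.instance Definition _ := GRing.Lalgebra_isComAlgebra.Build K (ratfun K).

Lemma ratfun_scaleE a x : a *: x = (a%:P)%:F * x.
Proof. by []. Qed.

Definition ratfun_t : ratfun K := 'X%:F.

Lemma ratfun_t_neq0 : ratfun_t != 0.
Proof. by rewrite tofrac_eq0 polyX_eq0. Qed.

Definition laurent_pred : {pred ratfun K} :=
  fun x => `[< exists n (p : {poly K}), x = p%:F / ratfun_t ^+ n >].

Fact laurent_subalg_closed : GRing.subalg_closed laurent_pred.
Proof.
split.
- by apply/asboolP; exists 0, 1; rewrite expr0 divr1 rmorph1.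
- move=> a _ _ /asboolP[m [p ->]] /asboolP[n [q ->]]; apply/asboolP.
  exists (m + n)%N, (a%:P * p * 'X^n + q * 'X^m).
  have t0 k : ratfun_t ^+ k != 0 by rewrite expf_neq0 ?ratfun_t_neq0.
  rewrite ratfun_scaleE rmorphD !rmorphM /= !rmorphXn /= -/ratfun_t.
  rewrite exprD invfM mulrDl [in X in _ = _ + X]mulrA mulfK //; congr (_ + _).
  by rewrite [_^-1 * _]mulrC [RHS]mulrA mulfK // mulrA.
- move=> _ _ /asboolP[m [p ->]] /asboolP[n [q ->]]; apply/asboolP.
  by exists (m + n)%N, (p * q); rewrite exprD invfM rmorphM mulrACA.
Qed.

HB.instance Definition _ := GRing.isSubalgClosed.Build K (ratfun K) laurent_pred
  laurent_subalg_closed.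

End RatFun.

Arguments laurent_pred : clear implicits.

(* The algebra K[t, t^-1], as the subalgebra of K(t) of all p / t^n. *)
Record laurent (K : fieldType) := Laurent {
  laurent_val :> ratfun K;
  _ : laurent_val \in laurent_pred K }.

Section Laurent.
Variable K : fieldType.

HB.instance Definition _ := [isSub for @laurent_val K].
HB.instance Definition _ := [Choice of laurent K by <:].
HB.instance Definition _ := [SubChoice_isSubComNzRing of laurent K by <:].
HB.instance Definition _ := [SubZmodule_isSubLmodule of laurent K by <:].
HB.instance Definition _ := [SubNzRing_SubLmodule_isSubLalgebra of laurent K by <:].
HB.instance Definition _ := [SubLalgebra_isSubAlgebra of laurent K by <:].

Fact laurent_t_subproof : ratfun_t K \in laurent_pred K.
Proof. by apply/asboolP; exists 0, 'X; rewrite expr0 divr1. Qed.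

Fact laurent_tV_subproof : (ratfun_t K)^-1 \in laurent_pred K.
Proof. by apply/asboolP; exists 1, 1; rewrite expr1 rmorph1 mul1r. Qed.

Definition laurent_t : laurent K := Laurent laurent_t_subproof.
Definition laurent_tV : laurent K := Laurent laurent_tV_subproof.

Lemma laurent_tK : laurent_t * laurent_tV = 1.
Proof. by apply: val_inj; rewrite /= divff ?ratfun_t_neq0. Qed.

Lemma laurent_tVK : laurent_tV * laurent_t = 1.
Proof. by rewrite mulrC laurent_tK. Qed.

End Laurent.

Inductive toeplitz_gen := Gen_v | Gen_w | Gen_e | Gen_f | Gen_es | Gen_fs.

HB.instance Definition _ := gen_eqMixin toeplitz_gen.
HB.instance Definition _ := gen_choiceMixin toeplitz_gen.

(* The defining relations, each as a pair (left-hand side, right-hand side);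
   es and fs stand for e^* and f^*. *)
Definition toeplitz_relations (A : nzRingType) (g : toeplitz_gen -> A) :
    seq (A * A) :=
  let v := g Gen_v in let w := g Gen_w in
  let e := g Gen_e in let f := g Gen_f in
  let es := g Gen_es in let fs := g Gen_fs in
  [:: (1, v + w);
      (v * v, v); (w * w, w); (v * w, 0); (w * v, 0);
      (v * e, e); (e * v, e); (v * f, f); (f * w, f);
      (v * es, es); (es * v, es); (w * fs, fs); (fs * v, fs);
      (es * e, v); (fs * f, w); (es * f, 0); (fs * e, 0);
      (v, e * es + f * fs)].

Lemma toeplitz_relations_rmorph (A B : nzRingType) (phi : {rmorphism A -> B})
    (g : toeplitz_gen -> A) :
  toeplitz_relations (fun i => phi (g i)) =
  [seq (phi r.1, phi r.2) | r <- toeplitz_relations g].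
Proof.
by rewrite /toeplitz_relations /= !rmorphD !rmorphM rmorph1 rmorph0.
Qed.

Section FreeAlgebra.
Variable K : fieldType.

(* The free associative unital algebra K<v, w, e, f, es, fs>. *)
Definition free_alg := {malg K[{fmonom toeplitz_gen}]}.

HB.instance Definition _ := GRing.Lalgebra.on free_alg.

Definition free_gen (i : toeplitz_gen) : free_alg := mkmalgU (fmu i) 1.

(* The algebra morphism free_alg -> B that extends g. *)
Variables (B : algType K) (g : toeplitz_gen -> B).

Definition monom_eval (m : {fmonom toeplitz_gen}) : B :=
  \prod_(i <- (m : seq _)) g i.

Fact monom_eval_mmorphism : mmorphism monom_eval.
Proof.
split; last by rewrite /monom_eval fm1 big_nil.
by move=> m1 m2; rewrite /monom_eval fmM big_cat.
Qed.

HB.instance Definition _ := isMultiplicative.Build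
  {fmonom toeplitz_gen} B monom_eval monom_eval_mmorphism.

Definition free_eval (x : free_alg) : B := mmap (in_alg B) monom_eval x.

Fact free_eval_zmod_morphism : zmod_morphism free_eval.
Proof. by move=> x y; rewrite /free_eval mmapB. Qed.

Fact free_eval_monoid_morphism : monoid_morphism free_eval.
Proof.
split; first exact: mmap1.
have [] : GRing.multiplicative free_eval; last by [].
apply: commr_mmap_is_multiplicative => x m m' /=; exact: comm_alg.
Qed.

Fact free_eval_scalable : scalable free_eval.
Proof. by move=> a x; rewrite /free_eval mmapZ mulr_algl. Qed.

HB.instance Definition _ := GRing.isZmodMorphism.Build free_alg B free_eval
  free_eval_zmod_morphism.
HB.instance Definition _ := GRing.isMonoidMorphism.Build free_alg B free_eval
  free_eval_monoid_morphism.
HB.instance Definition _ := GRing.isScalable.Build K free_alg B *:%R free_eval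
  free_eval_scalable.

Lemma free_eval_gen i : free_eval (free_gen i) = g i.
Proof.
by rewrite /free_eval mmapU /= scale1r mul1r /monom_eval fmU big_seq1.
Qed.

End FreeAlgebra.

Section Toeplitz.
Variable K : fieldType.

Fact free_scaleAr (a : K) (x y : free_alg K) : a *: (x * y) = x * (a *: y).
Proof.
apply/malgP=> k; rewrite mcoeffZ mcoeffMl.
rewrite (mcoeffMlw _ (finmap.fsubset_refl _) (msuppZ_le _ _)).
rewrite mulr_sumr; apply: eq_bigr => k1 _.
rewrite mulr_sumr; apply: eq_bigr => k2 _.
by rewrite mcoeffZ mulrnAr mulrCA.
Qed.

HB.instance Definition _ :=
  GRing.Lalgebra_isAlgebra.Build K (free_alg K) free_scaleAr.

Definition toeplitz_relators : set (free_alg K) :=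
  [set x | exists2 r, r \in toeplitz_relations (@free_gen K) & x = r.1 - r.2].

Definition toeplitz_ideal : {pred free_alg K} :=
  fun x => `[< ideal_gen toeplitz_relators x >].

Lemma toeplitz_idealP x :
  reflect (ideal_gen toeplitz_relators x) (x \in toeplitz_ideal).
Proof. exact: asboolP. Qed.

Lemma toeplitz_idealM (x y z : free_alg K) :
  x \in toeplitz_ideal -> y * x * z \in toeplitz_ideal.
Proof.
have [_ IM] := ideal_gen_is_ideal toeplitz_relators.
by move=> /toeplitz_idealP /(IM y) [/(IM z)[_ ?] _]; apply/toeplitz_idealP.
Qed.

Fact toeplitz_ideal_submod_closed : GRing.submod_closed toeplitz_ideal.
Proof.
have [/is_subspaceP[I0 ID] _] := ideal_gen_is_ideal toeplitz_relators.
split=> [|a x y /toeplitz_idealP Ix /toeplitz_idealP Iy]; apply/toeplitz_idealP.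
  exact: I0.
exact: ID.
Qed.

HB.instance Definition _ := GRing.isSubmodClosed.Build K (free_alg K)
  toeplitz_ideal toeplitz_ideal_submod_closed.

Definition toeplitz := {ideal_quot toeplitz_ideal}.

HB.instance Definition _ := GRing.Zmodule.on toeplitz.

Definition toeplitz_pi (x : free_alg K) : toeplitz :=
  \pi_{ideal_quot toeplitz_ideal} x.

Definition toeplitz_repr (x : toeplitz) : free_alg K :=
  repr (x : {ideal_quot toeplitz_ideal}).

Lemma toeplitz_reprK : cancel toeplitz_repr toeplitz_pi.
Proof. exact: reprK. Qed.

Lemma toeplitz_piP (x y : free_alg K) :
  toeplitz_pi x = toeplitz_pi y <-> ideal_gen toeplitz_relators (x - y).
Proof.
split=> [/eqP|/toeplitz_idealP].
  by rewrite -Quotient.idealrBE => /toeplitz_idealP.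
by rewrite Quotient.idealrBE => /eqP.
Qed.

Lemma toeplitz_piE (x y : free_alg K) :
  (toeplitz_pi x == toeplitz_pi y) = (x - y \in toeplitz_ideal).
Proof. by rewrite Quotient.idealrBE. Qed.

Fact toeplitz_pi_zmod_morphism : zmod_morphism toeplitz_pi.
Proof. by move=> x y; rewrite /toeplitz_pi -raddfB. Qed.

HB.instance Definition _ := GRing.isZmodMorphism.Build
  (free_alg K) toeplitz toeplitz_pi toeplitz_pi_zmod_morphism.

Definition toeplitz_one : toeplitz := toeplitz_pi 1.
Definition toeplitz_mul (x y : toeplitz) : toeplitz :=
  toeplitz_pi (toeplitz_repr x * toeplitz_repr y).
Definition toeplitz_scale (a : K) (x : toeplitz) : toeplitz :=
  toeplitz_pi (a *: toeplitz_repr x).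

Lemma toeplitz_repr_pi (x : free_alg K) :
  toeplitz_repr (toeplitz_pi x) - x \in toeplitz_ideal.
Proof. by rewrite -toeplitz_piE toeplitz_reprK. Qed.

Fact toeplitz_pi_mul x y :
  toeplitz_pi (x * y) = toeplitz_mul (toeplitz_pi x) (toeplitz_pi y).
Proof.
apply/esym/eqP; rewrite toeplitz_piE.
set x' := toeplitz_repr _; set y' := toeplitz_repr _.
rewrite (_ : _ - _ = 1 * (x' - x) * y' + x * (y' - y) * 1); last first.
  by rewrite mul1r mulr1 mulrBl mulrBr addrA subrK.
by rewrite rpredD // toeplitz_idealM // toeplitz_repr_pi.
Qed.

Fact toeplitz_pi_scale a x :
  toeplitz_pi (a *: x) = toeplitz_scale a (toeplitz_pi x).
Proof.
apply/esym/eqP.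
by rewrite toeplitz_piE -scalerBr rpredZ // toeplitz_repr_pi.
Qed.

Lemma toeplitz_ind (P : toeplitz -> Prop) :
  (forall x, P (toeplitz_pi x)) -> forall x, P x.
Proof. by move=> Ppi x; rewrite -[x]toeplitz_reprK. Qed.

Fact toeplitz_mulA : associative toeplitz_mul.
Proof.
elim/toeplitz_ind=> x; elim/toeplitz_ind=> y; elim/toeplitz_ind=> z.
by rewrite -!toeplitz_pi_mul mulrA.
Qed.

Fact toeplitz_mul1 : left_id toeplitz_one toeplitz_mul.
Proof. by elim/toeplitz_ind=> x; rewrite -toeplitz_pi_mul mul1r. Qed.

Fact toeplitz_mulr1 : right_id toeplitz_one toeplitz_mul.
Proof. by elim/toeplitz_ind=> x; rewrite -toeplitz_pi_mul mulr1. Qed.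

Fact toeplitz_mulDl : left_distributive toeplitz_mul +%R.
Proof.
elim/toeplitz_ind=> x; elim/toeplitz_ind=> y; elim/toeplitz_ind=> z.
by rewrite -raddfD -!toeplitz_pi_mul mulrDl raddfD.
Qed.

Fact toeplitz_mulDr : right_distributive toeplitz_mul +%R.
Proof.
elim/toeplitz_ind=> x; elim/toeplitz_ind=> y; elim/toeplitz_ind=> z.
by rewrite -raddfD -!toeplitz_pi_mul mulrDr raddfD.
Qed.

(* A family of elements of an algebra that satisfies the defining relations. *)
Definition toeplitz_family (B : nzRingType) (g : toeplitz_gen -> B) : Prop :=
  forall r, r \in toeplitz_relations g -> r.1 = r.2.

Lemma free_eval_ideal (B : algType K) (g : toeplitz_gen -> B) :
  toeplitz_family g -> forall x, x \in toeplitz_ideal -> free_eval g x = 0.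
Proof.
move=> gP x /toeplitz_idealP Ix.
apply: (Ix [set y | free_eval g y = 0]); split; first split.
- apply/is_subspaceP; split=> [|a y z /= gy gz]; first exact: raddf0.
  by rewrite linearP /= gy gz scaler0 addr0.
- by move=> a y /= gy; rewrite !rmorphM /= gy mulr0 mul0r.
- move=> _ [r rP ->] /=.
  suff: (free_eval g r.1, free_eval g r.2) \in toeplitz_relations g.
    by move=> /gP /= e; rewrite raddfB /= e subrr.
  have gE : g = fun i => free_eval g (free_gen K i).
    by apply/funext => i; rewrite free_eval_gen.
  rewrite [in toeplitz_relations g]gE (toeplitz_relations_rmorph (free_eval g)).
  exact: (map_f (fun s => (free_eval g s.1, free_eval g s.2))).
Qed.

Definition laurent_gen (i : toeplitz_gen) : laurent K :=
  match i with
  | Gen_v => 1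
  | Gen_e => laurent_t K
  | Gen_es => laurent_tV K
  | Gen_w | Gen_f | Gen_fs => 0
  end.

Fact laurent_gen_family : toeplitz_family laurent_gen.
Proof.
move=> r; rewrite !inE.
by do ![case/orP | move/eqP-> => /=];
   rewrite ?(mul1r, mulr1, mul0r, mulr0, addr0, laurent_tK, laurent_tVK).
Qed.

Fact toeplitz_one_neq0 : toeplitz_one != 0.
Proof.
rewrite /toeplitz_one -[0](raddf0 toeplitz_pi) toeplitz_piE subr0.
apply/negP => /(free_eval_ideal laurent_gen_family)/eqP.
by rewrite rmorph1 oner_eq0.
Qed.

HB.instance Definition _ := GRing.Zmodule_isNzRing.Build toeplitz
  toeplitz_mulA toeplitz_mul1 toeplitz_mulr1 toeplitz_mulDl toeplitz_mulDr
  toeplitz_one_neq0.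

Fact toeplitz_scaleA a b x :
  toeplitz_scale a (toeplitz_scale b x) = toeplitz_scale (a * b) x.
Proof.
by elim/toeplitz_ind: x => x; rewrite -!toeplitz_pi_scale scalerA.
Qed.

Fact toeplitz_scale1 : left_id 1 toeplitz_scale.
Proof. by elim/toeplitz_ind=> x; rewrite -toeplitz_pi_scale scale1r. Qed.

Fact toeplitz_scaleDr : right_distributive toeplitz_scale +%R.
Proof.
move=> a; elim/toeplitz_ind=> x; elim/toeplitz_ind=> y.
by rewrite -raddfD -!toeplitz_pi_scale scalerDr raddfD.
Qed.

Fact toeplitz_scaleDl x : {morph toeplitz_scale^~ x : a b / a + b}.
Proof.
elim/toeplitz_ind: x => x a b.
by rewrite -!toeplitz_pi_scale scalerDl raddfD.
Qed.

HB.instance Definition _ := GRing.Zmodule_isLmodule.Build K toeplitz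
  toeplitz_scaleA toeplitz_scale1 toeplitz_scaleDr toeplitz_scaleDl.

Fact toeplitz_scaleAl a (x y : toeplitz) : a *: (x * y) = (a *: x) * y.
Proof.
elim/toeplitz_ind: x => x; elim/toeplitz_ind: y => y.
rewrite -[a *: toeplitz_pi x]toeplitz_pi_scale.
rewrite -[LHS]/(toeplitz_scale a (toeplitz_mul _ _)) -[RHS]/(toeplitz_mul _ _).
by rewrite -!toeplitz_pi_mul -toeplitz_pi_scale scalerAl.
Qed.

HB.instance Definition _ :=
  GRing.Lmodule_isLalgebra.Build K toeplitz toeplitz_scaleAl.

Fact toeplitz_scaleAr a (x y : toeplitz) : a *: (x * y) = x * (a *: y).
Proof.
elim/toeplitz_ind: x => x; elim/toeplitz_ind: y => y.
rewrite -[a *: toeplitz_pi y]toeplitz_pi_scale.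
rewrite -[LHS]/(toeplitz_scale a (toeplitz_mul _ _)) -[RHS]/(toeplitz_mul _ _).
by rewrite -!toeplitz_pi_mul -toeplitz_pi_scale scalerAr.
Qed.

HB.instance Definition _ :=
  GRing.Lalgebra_isAlgebra.Build K toeplitz toeplitz_scaleAr.

HB.instance Definition _ := GRing.isMonoidMorphism.Build
  (free_alg K) toeplitz toeplitz_pi (erefl, toeplitz_pi_mul).
HB.instance Definition _ := GRing.isScalable.Build
  K (free_alg K) toeplitz *:%R toeplitz_pi toeplitz_pi_scale.

Lemma toeplitz_family_pi :
  toeplitz_family (fun i => toeplitz_pi (free_gen K i)).
Proof.
move=> r; rewrite (toeplitz_relations_rmorph toeplitz_pi) => /mapP[s sP ->] /=.
apply/toeplitz_piP; apply: sub_gen_smallest; by exists s.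
Qed.

Definition toeplitz_lift (B : algType K) (g : toeplitz_gen -> B)
    (x : toeplitz) : B :=
  free_eval g (toeplitz_repr x).

Lemma toeplitz_lift_pi (B : algType K) (g : toeplitz_gen -> B) :
  toeplitz_family g ->
  forall x, toeplitz_lift g (toeplitz_pi x) = free_eval g x.
Proof.
move=> gP x; apply/eqP; rewrite -subr_eq0 -raddfB; apply/eqP.
exact: free_eval_ideal (toeplitz_repr_pi x).
Qed.

Definition rho : toeplitz -> laurent K := toeplitz_lift laurent_gen.

Lemma rho_pi x : rho (toeplitz_pi x) = free_eval laurent_gen x.
Proof. exact/toeplitz_lift_pi/laurent_gen_family. Qed.

Fact rho_zmod_morphism : zmod_morphism rho.
Proof.
elim/toeplitz_ind=> x; elim/toeplitz_ind=> y.
by rewrite -raddfB !rho_pi raddfB.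
Qed.

Fact rho_monoid_morphism : monoid_morphism rho.
Proof.
split; first by rewrite -(rmorph1 toeplitz_pi) rho_pi rmorph1.
elim/toeplitz_ind=> x; elim/toeplitz_ind=> y.
by rewrite -rmorphM !rho_pi rmorphM.
Qed.

Fact rho_scalable : scalable rho.
Proof.
by move=> a; elim/toeplitz_ind=> x; rewrite -linearZ !rho_pi linearZ.
Qed.

HB.instance Definition _ :=
  GRing.isZmodMorphism.Build toeplitz (laurent K) rho rho_zmod_morphism.
HB.instance Definition _ :=
  GRing.isMonoidMorphism.Build toeplitz (laurent K) rho rho_monoid_morphism.
HB.instance Definition _ :=
  GRing.isScalable.Build K toeplitz (laurent K) *:%R rho rho_scalable.

Definition gen (i : toeplitz_gen) : toeplitz := toeplitz_pi (free_gen K i).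

Lemma rho_gen i : rho (gen i) = laurent_gen i.
Proof. by rewrite rho_pi free_eval_gen. Qed.

Local Notation w := (gen Gen_w).
Local Notation e := (gen Gen_e).
Local Notation es := (gen Gen_es).

Definition F_ideal : set toeplitz := ideal_gen [set w].

Definition s_ideal : set toeplitz := bracket_set F_ideal F_ideal.

(* [pchar K] is the set {l} if K has characteristic l > 0, and is empty if K
   has characteristic 0, where P_space is then the span of 1. *)
Definition P_space : set toeplitz :=
  lspan ([set 1] `|`
        [set x | exists l m : nat, [/\ l \in [pchar K], (1 <= m)%N &
                   x = e ^+ (m * l) \/ x = es ^+ (m * l)]]).

End Toeplitz.

Arguments gen : clear implicits.
Arguments F_ideal : clear implicits.
Arguments s_ideal : clear implicits.
Arguments P_space : clear implicits.

(* Main.v *)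
Require Import Defs.
From mathcomp Require Import all_boot all_order all_algebra.
From mathcomp Require Import boolp classical_sets.
From mathcomp.multinomials Require Import monalg.

Set Implicit Arguments.
Unset Strict Implicit.
Unset Printing Implicit Defensive.

Import GRing.Theory.

Local Open Scope classical_set_scope.
Local Open Scope ring_scope.

(** The algebra [T] is generated by [x = e + f] and [y = e^* + f^*], with
    [y x = 1] and [x y = v = 1 - w]; so it is the Jacobson algebra
    [K<x, y | y x = 1>].  The elements [E i j = x^i w y^j] multiply like matrix
    units.  They span [F], which is the algebra of finitary matrices, and
    [s = [F, F]] is spanned by the [E i j] with [i <> j] and the
    [E i i - E j j]: it is [sl_oo], so that [F = s + K w].  The quotient [T / F]
    is [K[t, t^-1]], by means of [rho]; it is commutative, so [T, T] lies in [F].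

    - Noncentral elements.  If a Lie ideal [L] contains [z] outside [K 1], then
      some [g = [a, z]] is not zero ([center_scalar]).  It lies in [L] and in
      [F], and it is a finite matrix with a nonzero entry; bracketing with
      matrix units whose index is beyond the size of [g] isolates this entry
      and puts some [E p q], [p <> q], in [L], and the brackets of [E p q] give
      all of [s] ([noncentral_contains_sl]).

    - If [F] is contained in [L], then [L] is the preimage of its image under
      [rho], as [F] is the kernel of [rho] ([ker_rho]).  Otherwise [w] is not in
      [L], since [F = s + K w].

    - The brackets modulo [s].  If [a] has degree [n] for the grading
      [deg x = 1], [deg y = -1], then [[a, c] = n [x, y a c]] modulo [s]
      ([degree_mod_monomial]): on the commutative algebra [T / F] the bracket is
      a pairing of the form [res (c da)], and [y] stands for [t^-1].  The last
      bracket is computed by [residue]: modulo [s] it is [- w] if [a c] has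
      degree [0], and zero otherwise.  Hence if [z] is in [L] and [w] is not, each
      homogeneous component of [rho z] has a degree that vanishes in [K]
      ([coef_degree0]), which means that [z] is in [s + P + K w]
      ([normalizer_sub_sPw]).  As [s] is in [L], this yields [L = s + U], where
      [U] is the intersection of [L] and [P + K w].

    Conversely, [[T, F]] is in [s] ([contains_sl_bracketF]), and the elements of
    [P] have degree zero in [K], so that [[T, P]] is in [s] as well
    ([P_s_bracket]): each [s + U] is a Lie ideal. *)

(** * Subspaces and brackets *)

Section SubspaceTheory.
Context {K : fieldType} {V : lmodType K}.
Implicit Types (S T : set V) (a : K) (u v : V).

Lemma subspace0 S : is_subspace S -> S 0.
Proof. by case/is_subspaceP. Qed.

Lemma subspaceD S u v : is_subspace S -> S u -> S v -> S (u + v).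
Proof. by case/is_subspaceP=> _ SP Su Sv; rewrite -[u]scale1r; apply: SP. Qed.

Lemma subspaceZ S a u : is_subspace S -> S u -> S (a *: u).
Proof.
by move=> sS Su; case/is_subspaceP: (sS) => S0 SP; rewrite -[_ *: _]addr0; apply: SP.
Qed.

Lemma subspaceN S u : is_subspace S -> S u -> S (- u).
Proof. by move=> sS Su; rewrite -scaleN1r; apply: subspaceZ. Qed.

Lemma subspaceB S u v : is_subspace S -> S u -> S v -> S (u - v).
Proof. by move=> sS Su Sv; apply: subspaceD => //; apply: subspaceN. Qed.

Lemma subspace_sum S (I : Type) (r : seq I) (G : I -> V) :
  is_subspace S -> (forall i, S (G i)) -> S (\sum_(i <- r) G i).
Proof.
move=> sS SG; apply: (big_ind S) => //; first exact: subspace0.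
by move=> u v; apply: subspaceD.
Qed.

Lemma subspace_congr S u v : is_subspace S -> S (u - v) -> S v -> S u.
Proof. by move=> sS Suv Sv; rewrite -[u](subrK v); apply: subspaceD. Qed.

Lemma lspan_subspace S : is_subspace (lspan S).
Proof.
apply/is_subspaceP; split=> [T [sT _]|a u v Su Sv T HT]; first exact: subspace0.
case: (HT) => sT _; apply: subspaceD => //; last exact: Sv.
by apply: subspaceZ => //; apply: Su.
Qed.

Lemma sub_lspan S : S `<=` lspan S.
Proof. exact: sub_gen_smallest. Qed.

Lemma lspan_sub S T : is_subspace T -> S `<=` T -> lspan S `<=` T.
Proof. by move=> sT ST; apply: smallest_sub. Qed.

Lemma lspan1P u v : lspan [set u] v <-> exists a, v = a *: u.
Proof.
split=> [|[a ->]]; last first.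
  exact: subspaceZ (lspan_subspace _) (sub_lspan erefl).
apply: (lspan_sub (T := [set v | exists a, v = a *: u])) => [|_ ->]; last first.
  by exists 1; rewrite scale1r.
apply/is_subspaceP; split=> [|b _ _ [c ->] [d ->]]; first by exists 0; rewrite scale0r.
by exists (b * c + d); rewrite scalerDl scalerA.
Qed.

Lemma sum_set_subspace S T :
  is_subspace S -> is_subspace T -> is_subspace (sum_set S T).
Proof.
move=> sS sT; apply/is_subspaceP; split.
  by exists 0; [exact: subspace0 | exists 0; [exact: subspace0 | rewrite addr0]].
move=> a _ _ [u1 Su1 [v1 Tv1 <-]] [u2 Su2 [v2 Tv2 <-]].
exists (a *: u1 + u2); first by apply: subspaceD => //; apply: subspaceZ.
exists (a *: v1 + v2); first by apply: subspaceD => //; apply: subspaceZ.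
by rewrite scalerDr addrACA.
Qed.

Lemma sum_set_l S T : is_subspace T -> S `<=` sum_set S T.
Proof.
move=> sT u Su; exists u => //.
by exists 0; [exact: subspace0 | rewrite addr0].
Qed.

Lemma sum_set_r S T : is_subspace S -> T `<=` sum_set S T.
Proof. by move=> sS u Tu; exists 0; [exact: subspace0 | exists u; rewrite ?add0r]. Qed.

End SubspaceTheory.

Section BracketTheory.
Context {K : fieldType} {A : algType K}.
Implicit Types (S : set A) (a b c : A).

Lemma bracketE a b : bracket a b = a * b - b * a. Proof. by []. Qed.

Lemma bracketC a b : bracket a b = - bracket b a.
Proof. by rewrite /bracket opprB. Qed.

Lemma bracketDr a b c : bracket a (b + c) = bracket a b + bracket a c.
Proof. by rewrite /bracket mulrDr mulrDl opprD addrACA. Qed.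

Lemma bracketZr (k : K) a b : bracket a (k *: b) = k *: bracket a b.
Proof. by rewrite /bracket -scalerAr -scalerAl scalerBr. Qed.

Lemma bracketBr a b c : bracket a (b - c) = bracket a b - bracket a c.
Proof. by rewrite bracketDr -scaleN1r bracketZr scaleN1r. Qed.

Lemma bracketDl a b c : bracket (a + b) c = bracket a c + bracket b c.
Proof. by rewrite bracketC bracketDr opprD -!bracketC. Qed.

Lemma bracketZl (k : K) a b : bracket (k *: a) b = k *: bracket a b.
Proof. by rewrite bracketC bracketZr -scalerN -bracketC. Qed.

Lemma bracket0r a : bracket a 0 = 0.
Proof. by rewrite /bracket mulr0 mul0r subrr. Qed.

Lemma bracket_sumr I (r : seq I) (G : I -> A) a :
  bracket a (\sum_(i <- r) G i) = \sum_(i <- r) bracket a (G i).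
Proof. by rewrite /bracket mulr_sumr mulr_suml sumrB. Qed.

(** The cyclic identity of the Hochschild differential; it reduces brackets
    with a product to brackets with its factors. *)
Lemma bracket_mul a b c : bracket (a * b) c = bracket a (b * c) + bracket b (c * a).
Proof. by rewrite /bracket !mulrA addrA subrK. Qed.

Lemma bracket_preimage_subspace S a :
  is_subspace S -> is_subspace [set b | S (bracket a b)].
Proof.
move=> sS; apply/is_subspaceP; split=> [|k b c /= Sb Sc].
  by rewrite /= bracket0r; apply: subspace0.
by rewrite bracketDr bracketZr; apply: subspaceD => //; apply: subspaceZ.
Qed.

End BracketTheory.

(** * Matrix units in an algebra with a one-sided inverse *)
Section JacobsonAlgebra.
Variables (K : fieldType) (A : algType K) (x y w : A).
Hypothesis yx1 : y * x = 1.
Hypothesis xyE : x * y = 1 - w.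
(* Generation by [x] and [y], as an induction principle. *)
Hypothesis xy_gen : forall S : set A, is_subspace S -> S 1 ->
  (forall a, S a -> S (x * a) /\ S (y * a)) -> forall a, S a.
Implicit Types (a b c g : A) (S : set A).

Definition mx_unit i j : A := x ^+ i * w * y ^+ j.
Local Notation E := mx_unit.
Local Notation F := (ideal_gen [set w]).

Lemma wE : w = 1 - x * y. Proof. by rewrite xyE subKr. Qed.

Lemma mulyw : y * w = 0.
Proof. by rewrite wE mulrBr mulrA yx1 mulr1 mul1r subrr. Qed.

Lemma mulwx : w * x = 0.
Proof. by rewrite wE mulrBl -mulrA yx1 mulr1 mul1r subrr. Qed.

Lemma mulww : w * w = w.
Proof. by rewrite {1}wE mulrBl -mulrA mulyw mulr0 mul1r subr0. Qed.

Lemma mulyX_x n : y ^+ n.+1 * x = y ^+ n.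
Proof. by rewrite exprSr -mulrA yx1 mulr1. Qed.

Lemma muly_xX n : y * x ^+ n.+1 = x ^+ n.
Proof. by rewrite exprS mulrA yx1 mul1r. Qed.

Lemma mulyX_xX n : y ^+ n * x ^+ n = 1.
Proof.
elim: n => [|n IH]; rewrite ?mulr1 //.
by rewrite exprSr exprS -mulrA (mulrA y) yx1 mul1r.
Qed.

Lemma mulyX_xX_le n m : (n <= m)%N -> y ^+ n * x ^+ m = x ^+ (m - n).
Proof. by move=> nm; rewrite -{1}(subnKC nm) exprD mulrA mulyX_xX mul1r. Qed.

Lemma mulyX_xX_ge n m : (m <= n)%N -> y ^+ n * x ^+ m = y ^+ (n - m).
Proof. by move=> nm; rewrite -{1}(subnK nm) exprD -mulrA mulyX_xX mulr1. Qed.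

Lemma mulyXw n : (0 < n)%N -> y ^+ n * w = 0.
Proof. by case: n => // n _; rewrite exprSr -mulrA mulyw mulr0. Qed.

Lemma mulwxX n : (0 < n)%N -> w * x ^+ n = 0.
Proof. by case: n => // n _; rewrite exprS mulrA mulwx mul0r. Qed.

Lemma mulwyxw i j : w * (y ^+ i * x ^+ j) * w = if i == j then w else 0.
Proof.
case: ltngtP => [ij|ij|->].
- by rewrite mulyX_xX_le 1?ltnW // mulwxX ?mul0r // subn_gt0.
- by rewrite mulyX_xX_ge 1?ltnW // -mulrA mulyXw ?mulr0 // subn_gt0.
- by rewrite mulyX_xX mulr1 mulww.
Qed.

Lemma mx_unitM i j k l : E i j * E k l = if j == k then E i l else 0.
Proof.
have -> : E i j * E k l = x ^+ i * (w * (y ^+ j * x ^+ k) * w) * y ^+ l.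
  by rewrite /E !mulrA.
by rewrite mulwyxw; case: eqP; rewrite ?mulr0 ?mul0r.
Qed.

Lemma mulx_unit i j : x * E i j = E i.+1 j.
Proof. by rewrite /E exprS !mulrA. Qed.

Lemma muly_unit i j : y * E i j = if i is i'.+1 then E i' j else 0.
Proof.
case: i => [|i]; first by rewrite /E expr0 mul1r mulrA mulyw mul0r.
by rewrite /E !mulrA muly_xX.
Qed.

Lemma mul_unitx i j : E i j * x = if j is j'.+1 then E i j' else 0.
Proof.
case: j => [|j]; first by rewrite /E expr0 mulr1 -mulrA mulwx mulr0.
by rewrite /E -!mulrA mulyX_x.
Qed.

Lemma mul_unity i j : E i j * y = E i j.+1.
Proof. by rewrite /E exprSr !mulrA. Qed.

Lemma ideal_w a b : F (a * w * b).
Proof.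
have [_ FM] := ideal_gen_is_ideal [set w].
by have [_ H] := FM b (a * w) (FM a w (sub_gen_smallest erefl)).1.
Qed.

Lemma F_subspace : is_subspace F.
Proof. by have [] := ideal_gen_is_ideal [set w]. Qed.

Lemma F_unit i j : F (E i j). Proof. exact: ideal_w. Qed.

(** The idempotent [1 - x^N y^N] is the identity matrix of size [N]. *)
Lemma sub1xXyX N : 1 - x ^+ N * y ^+ N = \sum_(i < N) E i i.
Proof.
elim: N => [|N IH]; first by rewrite big_ord0 mulr1 subrr.
rewrite big_ord_recr /= -IH /E wE mulrBr mulrBl mulr1 addrA subrK.
by rewrite exprSr exprS !mulrA.
Qed.

(** The elements killed by a high power of [y] on the left and of [x] on the
    right form an ideal, because [y^M a] is in [A y^N] and [a x^M] in [x^N A]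
    for each [a] and all large [M].  These elements are the finite matrices. *)
Lemma F_finite g : F g -> exists N, y ^+ N * g = 0 /\ g * x ^+ N = 0.
Proof.
pose G := [set g | exists N, y ^+ N * g = 0 /\ g * x ^+ N = 0].
have mono N M b : (N <= M)%N -> y ^+ N * b = 0 -> y ^+ M * b = 0.
  by move=> NM e; rewrite -(subnK NM) exprD -mulrA e mulr0.
have monox N M b : (N <= M)%N -> b * x ^+ N = 0 -> b * x ^+ M = 0.
  by move=> NM e; rewrite -(subnKC NM) exprD mulrA e mul0r.
apply: (@smallest_sub _ is_ideal [set w] G); last first.
  by move=> _ ->; exists 1%N; rewrite !expr1 mulyw mulwx.
split.
  apply/is_subspaceP; split; first by exists 0%N; rewrite mulr0 mul0r.
  move=> k a b [N [Na aN]] [M [Mb bM]]; exists (maxn N M).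
  rewrite mulrDr mulrDl -scalerAr -scalerAl.
  rewrite (mono _ _ _ (leq_maxl N M) Na) (mono _ _ _ (leq_maxr N M) Mb).
  rewrite (monox _ _ _ (leq_maxl N M) aN) (monox _ _ _ (leq_maxr N M) bM).
  by rewrite scaler0 addr0.
have yP a : forall N, exists M b, y ^+ M * a = b * y ^+ N.
  apply: (xy_gen (S := [set a | forall N, exists M b, y ^+ M * a = b * y ^+ N])).
  - apply/is_subspaceP; split=> [N|k {}a b Ha Hb N].
      by exists 0%N, 0; rewrite mulr0 mul0r.
    have [[M1 [c1 e1]] [M2 [c2 e2]]] := (Ha N, Hb N).
    exists (M1 + M2)%N, (k *: (y ^+ M2 * c1) + y ^+ M1 * c2).
    rewrite mulrDr mulrDl -scalerAr -scalerAl {1}addnC !exprD -!mulrA.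
    by rewrite e1 e2.
  - by move=> N; exists N, 1; rewrite mulr1 mul1r.
  move=> {}a Ha; split=> N; have [M [b e]] := Ha N.
    by exists M.+1, b; rewrite mulrA mulyX_x.
  by exists M, (y * b); rewrite mulrA -exprSr exprS -!mulrA e.
have xP a : forall N, exists M b, a * x ^+ M = x ^+ N * b.
  apply: (xy_gen (S := [set a | forall N, exists M b, a * x ^+ M = x ^+ N * b])).
  - apply/is_subspaceP; split=> [N|k {}a b Ha Hb N].
      by exists 0%N, 0; rewrite mulr0 mul0r.
    have [[M1 [c1 e1]] [M2 [c2 e2]]] := (Ha N, Hb N).
    exists (M1 + M2)%N, (k *: (c1 * x ^+ M2) + c2 * x ^+ M1).
    rewrite mulrDr mulrDl -scalerAr -scalerAl {2}addnC !exprD !mulrA.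
    by rewrite e1 e2.
  - by move=> N; exists N, 1; rewrite mulr1 mul1r.
  move=> {}a Ha; split=> N.
    have [M [b e]] := Ha N.
    by exists M, (x * b); rewrite -mulrA e !mulrA -exprS exprSr.
  have [M [b e]] := Ha N.+1.
  by exists M, b; rewrite -mulrA e mulrA muly_xX.
move=> a {}g [N [Ng gN]]; split.
  have [M [b e]] := yP a N; exists (maxn M N); split.
    by apply: mono (leq_maxl M N) _; rewrite mulrA e -mulrA Ng mulr0.
  by apply: monox (leq_maxr M N) _; rewrite -mulrA gN mulr0.
have [M [b e]] := xP a N; exists (maxn M N); split.
  by apply: mono (leq_maxr M N) _; rewrite mulrA Ng mul0r.
by apply: monox (leq_maxl M N) _; rewrite -mulrA e mulrA gN mul0r.
Qed.

(** The corner [w A w] is [K w], and the scalar given here is the [(i, j)] entry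
    of [a] in the action of [A] on the space with basis [x^n w]. *)
Lemma entry_exists a i j : exists k : K, w * (y ^+ i * a * x ^+ j) * w = k *: w.
Proof.
move: a i j; apply: (xy_gen (S := [set a | forall i j, exists k : K,
  w * (y ^+ i * a * x ^+ j) * w = k *: w])).
- apply/is_subspaceP; split=> [i j|k a b Ha Hb i j].
    by exists 0; rewrite !(mulr0, mul0r) scale0r.
  have [[k1 e1] [k2 e2]] := (Ha i j, Hb i j); exists (k * k1 + k2).
  rewrite mulrDr -scalerAr !mulrDl mulrDr mulrDl -!(scalerAl, scalerAr).
  by rewrite e1 e2 scalerDl scalerA.
- move=> i j; rewrite /= mulr1 mulwyxw; case: eqP => _.
    by exists 1; rewrite scale1r.
  by exists 0; rewrite scale0r.
move=> a Ha; split=> i j; last first.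
  by have [k e] := Ha i.+1 j; exists k; rewrite -e exprSr !mulrA.
case: i => [|i].
  by exists 0; rewrite mul1r !mulrA mulwx !mul0r scale0r.
by have [k e] := Ha i j; exists k; rewrite -e (mulrA _ x) mulyX_x.
Qed.

Lemma compress_unit a i j :
  E i i * a * E j j = x ^+ i * (w * (y ^+ i * a * x ^+ j) * w) * y ^+ j.
Proof. by rewrite /E !mulrA. Qed.

(** Both conditions say that the idempotent [1 - x^N y^N] fixes [g], on the left
    and on the right. *)
Lemma finite_decomp g N : y ^+ N * g = 0 -> g * x ^+ N = 0 ->
  g = \sum_(i < N) \sum_(j < N) E i i * g * E j j.
Proof.
move=> Ng gN; under eq_bigr => i _ do rewrite -mulr_sumr.
rewrite -!mulr_suml -sub1xXyX mulrBl mul1r -mulrA Ng mulr0 subr0.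
by rewrite mulrBr mulr1 mulrA gN mul0r subr0.
Qed.

Lemma F_ind S : is_subspace S -> (forall i j, S (E i j)) -> F `<=` S.
Proof.
move=> sS SE g /F_finite[N [Ng gN]]; rewrite (finite_decomp Ng gN).
apply: subspace_sum => // i; apply: subspace_sum => // j.
have [k] := entry_exists g i j; rewrite compress_unit => ->.
by rewrite -scalerAr -scalerAl; apply: subspaceZ => //; apply: SE.
Qed.

Lemma nonzero_entry g : F g -> g <> 0 ->
  exists i j (k : K), k != 0 /\ w * (y ^+ i * g * x ^+ j) * w = k *: w.
Proof.
move=> /F_finite[N [Ng gN]] g0; apply: contrapT => H; apply: g0.
rewrite (finite_decomp Ng gN) big1 // => i _; rewrite big1 // => j _.
have [k e] := entry_exists g i j; rewrite compress_unit e.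
have [->|k0] := eqVneq k 0; first by rewrite scale0r mulr0 mul0r.
by case: H; exists i, j, k.
Qed.

(** * The Lie algebra of traceless finite matrices *)

(** The subspace [S] contains [s], expressed by the standard spanning set of
    [sl_oo]. *)
Definition contains_sl S :=
  [/\ is_subspace S, forall i j, i != j -> S (E i j) &
      forall i j, S (E i i - E j j)].
Local Notation s := (bracket_set F F).

Lemma s_subspace : is_subspace s. Proof. exact: lspan_subspace. Qed.

Lemma s_bracket g h : F g -> F h -> s (bracket g h).
Proof. by move=> Fg Fh; apply: sub_lspan; exists g => //; exists h. Qed.

Lemma s_contains_sl : contains_sl s.
Proof.
have sbr i j k l : s (bracket (E i j) (E k l)) by apply: s_bracket; apply: F_unit.
split=> [|i j ij|i j]; first exact: s_subspace.
  have := sbr i i i j; rewrite bracketE !mx_unitM eqxx.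
  by rewrite eq_sym (negPf ij) subr0.
by have := sbr i j j i; rewrite bracketE !mx_unitM !eqxx.
Qed.

(** For the generators this is [[x, E i j] = E (i+1) j - E i (j-1)] and its
    analogue for [y]; [bracket_mul] then reaches all [a], as [F] is an ideal. *)
Lemma contains_sl_bracketF S : contains_sl S -> forall a g, F g -> S (bracket a g).
Proof.
case=> sS Soff Sdiag.
have S0 := subspace0 sS.
have Sx g : F g -> S (bracket x g).
  apply: (F_ind (bracket_preimage_subspace x sS)) => i j /=.
  rewrite bracketE mulx_unit mul_unitx; case: j => [|j].
    by rewrite subr0; apply: Soff.
  have [->|ij] := eqVneq i j; first exact: Sdiag.
  by apply: subspaceB => //; apply: Soff.
have Sy g : F g -> S (bracket y g).
  apply: (F_ind (bracket_preimage_subspace y sS)) => i j /=.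
  rewrite bracketE muly_unit mul_unity; case: i => [|i].
    by rewrite sub0r; apply: subspaceN => //; apply: Soff.
  have [->|ij] := eqVneq i j; first exact: Sdiag.
  by apply: subspaceB => //; apply: Soff.
have [_ FM] := ideal_gen_is_ideal [set w].
apply: (xy_gen (S := [set a | forall g, F g -> S (bracket a g)])).
- apply/is_subspaceP; split=> [g Fg|k a b Ha Hb g Fg].
    by rewrite bracketC bracket0r oppr0.
  rewrite bracketDl bracketZl; apply: subspaceD => //; last exact: Hb.
  by apply: subspaceZ => //; apply: Ha.
- by move=> g Fg /=; rewrite bracketE mulr1 mul1r subrr.
move=> a Ha; split=> g Fg; rewrite bracket_mul; apply: subspaceD => //.
- by apply: Sx; apply: (FM _ _ _).1.
- by apply: Ha; apply: (FM _ _ _).2.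
- by apply: Sy; apply: (FM _ _ _).1.
- by apply: Ha; apply: (FM _ _ _).2.
Qed.

Lemma s_sub_of_contains_sl S : contains_sl S -> s `<=` S.
Proof.
move=> slS; case: (slS) => sS _ _; apply: lspan_sub => // _ [a _ [g Fg <-]].
exact: contains_sl_bracketF.
Qed.

Lemma s_sub_F : s `<=` F.
Proof.
apply: s_sub_of_contains_sl; split=> [|i j _|i j]; first exact: F_subspace.
  exact: F_unit.
exact: subspaceB F_subspace (F_unit _ _) (F_unit _ _).
Qed.

Lemma F_sub_of_w S : contains_sl S -> S w -> F `<=` S.
Proof.
case=> sS Soff Sdiag Sw; apply: F_ind => // i j.
have [<-|/Soff //] := eqVneq i j.
by rewrite -[E i i](subrK (E 0 0)); apply: subspaceD => //; rewrite /E mul1r mulr1.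
Qed.

Lemma F_mul a g : F g -> F (a * g) /\ F (g * a).
Proof. by move=> Fg; have [_ FM] := ideal_gen_is_ideal [set w]; apply: FM. Qed.

(** [A / F] is commutative: its generators [x] and [y] are inverse to each
    other, since [[y, x] = w]. *)
Lemma F_bracket a b : F (bracket a b).
Proof.
have sF := F_subspace.
have Fw : F w by apply: sub_gen_smallest.
have der (c d f : A) : bracket c (d * f) = bracket c d * f + d * bracket c f.
  by rewrite /bracket mulrBl mulrBr !mulrA addrA subrK.
have step c : F (bracket c x) -> F (bracket c y) -> forall d, F (bracket c d).
  move=> Fx Fy; apply: xy_gen => [||d Fd].
  - exact: (bracket_preimage_subspace c sF).
  - by rewrite /= bracketE mulr1 mul1r subrr; apply: (subspace0 sF).
  rewrite /= !der; split; apply: (subspaceD sF) => //.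
  - exact: (F_mul _ _).2.
  - exact: (F_mul _ _).1.
  - exact: (F_mul _ _).2.
  - exact: (F_mul _ _).1.
have Fyx : F (bracket y x) by rewrite bracketE yx1 xyE subKr.
have Fx : forall d, F (bracket x d).
  apply: step; first by rewrite bracketE subrr; apply: (subspace0 sF).
  by rewrite bracketC; apply: (subspaceN sF).
have Fy : forall d, F (bracket y d).
  by apply: step => //; rewrite bracketE subrr; apply: (subspace0 sF).
move: b; apply: (xy_gen (S := [set a | forall b, F (bracket a b)])) a => [||a /= Fa].
- apply/is_subspaceP; split=> [b|k a c /= Ha Hc b].
    by rewrite bracketC bracket0r oppr0; apply: (subspace0 sF).
  rewrite bracketDl bracketZl; apply: (subspaceD sF) => //.
  exact: subspaceZ sF (Ha _).
- by move=> b /=; rewrite bracketE mulr1 mul1r subrr; apply: (subspace0 sF).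
by split=> b; rewrite bracket_mul; apply: (subspaceD sF) (Fa _).
Qed.

Lemma F_sub1xXyX N : F (1 - x ^+ N * y ^+ N).
Proof.
by rewrite sub1xXyX; apply: (subspace_sum _ F_subspace) => i; apply: F_unit.
Qed.

(** Modulo [F], [y] is the inverse of [x] and all elements commute, so that an
    element of [A / F] is a polynomial in [x] divided by a power of [x]. *)
Lemma normal_form a : exists (p : {poly K}) N, F (a - horner_alg x p * y ^+ N).
Proof.
have sF := F_subspace.
have shift (p : {poly K}) N M :
    F (horner_alg x p * y ^+ N - horner_alg x (p * 'X^M) * y ^+ (M + N)).
  rewrite rmorphM /= rmorphXn /= horner_algX exprD.
  rewrite (_ : _ - _ = horner_alg x p * (1 - x ^+ M * y ^+ M) * y ^+ N).
    exact: (F_mul _ (F_mul _ (F_sub1xXyX M)).1).2.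
  by rewrite mulrBr mulrBl mulr1 !mulrA.
move: a; apply: (xy_gen (S := [set a | exists (p : {poly K}) N,
    F (a - horner_alg x p * y ^+ N)])).
- apply/is_subspaceP; split.
    by exists 0, 0%N; rewrite rmorph0 mul0r subrr; apply: (subspace0 sF).
  move=> k a b [p [N Ha]] [q [M Hb]].
  exists (k *: (p * 'X^M) + q * 'X^N), (M + N)%N.
  have {}Ha := subspaceD sF Ha (shift p N M).
  have {}Hb := subspaceD sF Hb (shift q M N).
  rewrite !addrA !subrK in Ha Hb.
  have := subspaceD sF (subspaceZ k sF Ha) Hb; congr (F _).
  rewrite rmorphD /= linearZ /= mulr_algl mulrDl -scalerAl scalerBr addrACA.
  by rewrite -opprD (addnC N).
- by exists 1, 0%N; rewrite rmorph1 mul1r subrr; apply: (subspace0 sF).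
move=> a [p [N Ha]]; split.
  exists ('X * p), N; rewrite rmorphM /= horner_algX -mulrA -mulrBr.
  exact: (F_mul _ _).1.
exists p, N.+1.
rewrite (_ : _ - _ = y * (a - horner_alg x p * y ^+ N) +
                     bracket y (horner_alg x p * y ^+ N)).
  by apply: (subspaceD sF) (F_bracket _ _); apply: (F_mul _ _).1.
by rewrite bracketE mulrBr addrA subrK -mulrA -exprSr.
Qed.

Lemma horner_alg_sum (p : {poly K}) :
  horner_alg x p = \sum_(k < size p) p`_k *: x ^+ k.
Proof.
rewrite -{1}[p]coefK poly_def linear_sum /=; apply: eq_bigr => k _.
by rewrite linearZ /= mulr_algl rmorphXn /= horner_algX.
Qed.

(** For [a = p(x) y^m + g] with [g x^N = 0], the matrix of [a x^(m + N)] is that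
    of [p(x) x^N], in which the coefficients of [p] can be read. *)
Lemma entries_faithful a : w <> 0 ->
  (forall i j, w * (y ^+ i * a * x ^+ j) * w = 0) -> a = 0.
Proof.
move=> w0 a0; have [p [m Fg]] := normal_form a.
set g := _ - _ in Fg; have [N [_ gN]] := F_finite Fg.
have kw (k : K) : k *: w = 0 -> k = 0.
  by move/eqP; rewrite scaler_eq0 => /orP[/eqP|/eqP /w0].
suff p0 : p = 0.
  have ga : g = a by rewrite /g p0 rmorph0 mul0r subr0.
  apply: contrapT => /(nonzero_entry (eq_ind _ F Fg _ ga))[i [j [k [/eqP k0]]]].
  by rewrite a0 => /esym/kw.
have ax : a * x ^+ (m + N) = horner_alg x p * x ^+ N.
  have -> : a = g + horner_alg x p * y ^+ m by rewrite subrK.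
  rewrite mulrDl {1}addnC !exprD mulrA gN mul0r add0r.
  by rewrite -mulrA (mulrA (y ^+ m)) mulyX_xX mul1r.
apply/polyP => k; rewrite coef0.
have := a0 (k + N)%N (m + N)%N.
rewrite -(mulrA _ a) ax horner_alg_sum mulr_suml !mulr_sumr mulr_suml.
under eq_bigr => l _.
  rewrite -scalerAl -!scalerAr -scalerAl -exprD mulwyxw eqn_add2r eq_sym.
  rewrite (fun_if ( *:%R _)) scaler0.
  over.
rewrite -big_mkcond (big_ord1_eq _ (fun l => p`_l *: w)).
by case: ltnP => [_ /kw|/leq_sizeP->].
Qed.

(** * The map to Laurent polynomials *)

Variable rho : {lrmorphism A -> laurent K}.
Hypothesis rho_x : rho x = laurent_t K.
Hypothesis rho_y : rho y = laurent_tV K.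

Lemma laurent_val_rho (p : {poly K}) :
  laurent_val (rho (horner_alg x p)) = FracField.tofrac p.
Proof.
elim/poly_ind: p => [|p c IH]; first by rewrite !rmorph0.
rewrite !rmorphD !rmorphM /= horner_algX horner_algC rho_x linearZ /= rmorph1.
by rewrite IH ratfun_scaleE mulr1.
Qed.

Lemma rho_F g : F g -> rho g = 0.
Proof.
have rho_w : rho w = 0.
  by rewrite wE rmorphB rmorphM rmorph1 /= rho_x rho_y laurent_tK subrr.
apply: (F_ind (S := [set g | rho g = 0])) => [|i j /=].
  apply/is_subspaceP; split=> [|k a b /= a0 b0]; first exact: rmorph0.
  by rewrite linearP /= a0 b0 scaler0 addr0.
by rewrite !rmorphM /= rho_w mulr0 mul0r.
Qed.

(** If [a = p(x) y^N] modulo [F], then [rho a] is the fraction [p(t) / t^N],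
    which vanishes only if [p = 0]. *)
Lemma ker_rho a : rho a = 0 -> F a.
Proof.
move=> ra; have [p [N Fg]] := normal_form a.
have := rho_F Fg; rewrite rmorphB rmorphM rmorphXn /= ra sub0r rho_y.
move/(congr1 (fun u => - u * laurent_t K ^+ N)).
rewrite opprK oppr0 mul0r -mulrA -exprMn laurent_tVK expr1n mulr1.
move/(congr1 (@laurent_val K)); rewrite laurent_val_rho => /eqP.
rewrite tofrac_eq0 => /eqP p0.
by rewrite p0 rmorph0 mul0r subr0 in Fg.
Qed.

Lemma F_congr a b : rho a = rho b -> F (a - b).
Proof. by move=> rab; apply: ker_rho; rewrite rmorphB /= rab subrr. Qed.

(** * Brackets modulo traceless matrices *)

(** [a] behaves in brackets as a homogeneous element of degree [n]: the scalar
    [n] is its degree in [K], and [c |-> bracket x (y * c)] modulo [S] plays the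
    role of the residue of [c dt / t]. *)
Definition degree_mod S a (n : K) :=
  forall c, S (bracket a c - n *: bracket x (y * a * c)).

Section DegreeMod.
Variable S : set A.
Hypothesis slS : contains_sl S.
Let sS : is_subspace S. Proof. by case: slS. Qed.
Let SF := contains_sl_bracketF slS.

(** The Leibniz rule, from [bracket_mul]; the order of the factors inside the
    bracket with [x] is irrelevant modulo [[A, F]]. *)
Lemma degree_modM a b n m :
  degree_mod S a n -> degree_mod S b m -> degree_mod S (a * b) (n + m).
Proof.
move=> da db c; rewrite bracket_mul.
have Fr : F (y * b * (c * a) - y * (a * b) * c).
  apply: F_congr; rewrite !rmorphM /= -!mulrA; congr (_ * _).
  by rewrite mulrA mulrC.
have := subspaceD sS (subspaceD sS (da (b * c)) (db (c * a)))
  (subspaceZ m sS (SF x Fr)).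
congr (S _).
rewrite bracketBr -!mulrA.
move: (bracket a _) (bracket b _) (bracket x (y * (b * _))) (bracket x _) => u v V T.
by rewrite scalerBr !addrA subrK scalerDl opprD addrA (addrAC u).
Qed.

Lemma degree_mod1 : degree_mod S 1 0.
Proof.
by move=> c; rewrite scale0r subr0 bracketE mul1r mulr1 subrr; apply: subspace0.
Qed.

Lemma degree_modx : degree_mod S x 1.
Proof. by move=> c; rewrite scale1r yx1 mul1r subrr; apply: subspace0. Qed.

(** [[y x, c] = 0], expanded by [bracket_mul], compares [y] with [x]. *)
Lemma degree_mody : degree_mod S y (-1).
Proof.
move=> c.
have e : bracket y (x * (y * c)) + bracket x (y * c * y) = 0.
  by rewrite -bracket_mul yx1 bracketE mul1r mulr1 subrr.
have Fw : F (c - x * (y * c)).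
  by apply: F_congr; rewrite !rmorphM /= mulrA rho_x rho_y laurent_tK mul1r.
have Fy : F (y * y * c - y * c * y).
  by apply: F_congr; rewrite !rmorphM /= -!mulrA; congr (_ * _); rewrite mulrC.
have := subspaceD sS (SF y Fw) (SF x Fy).
congr (S _).
rewrite !bracketBr.
by rewrite addrACA -opprD e subr0 scaleN1r opprK.
Qed.

Lemma degree_modX a n k : degree_mod S a n -> degree_mod S (a ^+ k) (n *+ k).
Proof.
move=> da; elim: k => [|k IH]; first by rewrite expr0 mulr0n; apply: degree_mod1.
by rewrite exprS mulrS; apply: degree_modM.
Qed.

Lemma degree_mod_monomial k m : degree_mod S (x ^+ k * y ^+ m) (k%:R - m%:R).
Proof.
rewrite -mulNrn; apply: degree_modM; apply: degree_modX.
  exact: degree_modx.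
exact: degree_mody.
Qed.

Lemma degree_mod_congr a b n : F (a - b) -> degree_mod S b n -> degree_mod S a n.
Proof.
move=> Fab db c.
rewrite -[a](subrK b); set d := a - b in Fab *.
rewrite bracketDl mulrDr mulrDl bracketDr scalerDr opprD addrACA.
apply: (subspaceD sS) (db c); apply: (subspaceB sS).
  by rewrite bracketC; apply: (subspaceN sS); apply: SF.
by apply: (subspaceZ _ sS); apply: SF; apply: (F_mul _ (F_mul _ Fab).1).2.
Qed.

(** The element [[x, y a c]], for [a = x^k y^m] and [c = x^m y^j], telescopes to
    minus one matrix unit, diagonal exactly for [k = j]; for [j = 0 < k] it is
    zero. *)
Lemma residue k m j :
  S (bracket x (y * (x ^+ k * y ^+ m) * (x ^+ m * y ^+ j)) +
     (if k == j then w else 0)).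
Proof.
have -> : y * (x ^+ k * y ^+ m) * (x ^+ m * y ^+ j) = y * x ^+ k * y ^+ j.
  by rewrite !mulrA -(mulrA _ (y ^+ m)) mulyX_xX mulr1.
have S0 := subspace0 sS; case: (slS) => _ Soff Sdiag.
have E00 : w = E 0 0 by rewrite /E mul1r mulr1.
have key i j' : bracket x (x ^+ i * y ^+ j'.+1) = - E i j'.
  rewrite bracketE /E wE mulrBr mulrBl mulr1 opprB.
  by rewrite -mulrA mulyX_x mulrA -exprS exprSr exprS !mulrA.
case: k => [|k].
  rewrite expr0 mulr1 -exprS -[y ^+ _]mul1r -(expr0 x) key.
  case: eqP => [<-|/eqP jk]; first by rewrite -E00 addNr.
  by rewrite addr0; apply: subspaceN => //; apply: Soff.
rewrite muly_xX; case: j => [|j].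
  by rewrite mulr1 bracketE -exprS -exprSr subrr addr0.
rewrite key eqSS addrC {1}E00; case: eqP => [->|/eqP kj]; first exact: Sdiag.
by rewrite sub0r; apply: subspaceN => //; apply: Soff.
Qed.

(** The test element [c = x^m y^j] has degree opposite to that of [x^j y^m], so
    that the bracket with [c] isolates the coefficient [p`_j]. *)
Lemma coef_degree0 z (p : {poly K}) m :
  ~ S w -> (forall a, S (bracket a z)) -> F (z - horner_alg x p * y ^+ m) ->
  forall j, p`_j * (j%:R - m%:R) = 0.
Proof.
move=> Sw Sz Fz j; set c := x ^+ m * y ^+ j.
pose r k := bracket x (y * (x ^+ k * y ^+ m) * c).
have Sm k : S (bracket c (x ^+ k * y ^+ m) - (k%:R - m%:R) *: (if k == j then w else 0)).
  have := subspaceN sS (subspaceD sS (degree_mod_monomial k m c)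
     (subspaceZ (k%:R - m%:R) sS (residue k m j))).
  congr (S _); rewrite (bracketC c); move: (bracket _ c) (bracket x _) => u v.
  by rewrite scalerDr addrA subrK opprD.
have : S (bracket c (horner_alg x p * y ^+ m)).
  have := subspaceB sS (Sz c) (SF c Fz).
  by rewrite bracketBr subKr.
rewrite horner_alg_sum mulr_suml bracket_sumr => Ssum.
have := subspaceB sS Ssum (subspace_sum (index_enum 'I_(size p)) sS
   (fun k : 'I_(size p) => subspaceZ p`_k sS (Sm k))).
rewrite -sumrB.
under eq_bigr => k _.
  rewrite -scalerAl bracketZr -scalerBr subKr.
  rewrite (fun_if ( *:%R (k%:R - m%:R))) (fun_if ( *:%R p`_k)) !scaler0.
  over.
rewrite -big_mkcond (big_ord1_eq _ (fun l => p`_l *: ((l%:R - m%:R) *: w))).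
case: ltnP => [_|/leq_sizeP -> //]; last by rewrite mul0r.
rewrite scalerA => Sj; apply: contrapT => /eqP j0; apply: Sw.
by rewrite -[w]scale1r -(mulVf j0) -scalerA; apply: subspaceZ.
Qed.

End DegreeMod.

(** * Lie ideals that contain a noncentral element *)

(** If [w z w = k w], then [z w = k w] as [z] and [w] commute; as [z] also
    commutes with [x], all entries of [z - k] vanish. *)
Lemma center_scalar z : w <> 0 -> (forall a, bracket a z = 0) ->
  exists k : K, z = k *: 1.
Proof.
move=> w0 zC; have [k] := entry_exists z 0 0.
rewrite mul1r mulr1 => wzw; exists k.
have zw : z * w = k *: w.
  have /eqP := zC w; rewrite bracketE subr_eq0 => /eqP e.
  by rewrite -wzw e -mulrA mulww.
apply/eqP; rewrite -subr_eq0; apply/eqP/entries_faithful => // i j.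
have zX : z * x ^+ j = x ^+ j * z.
  by have /eqP := zC (x ^+ j); rewrite bracketE subr_eq0 => /eqP.
have d0 : (z - k *: 1) * x ^+ j * w = 0.
  by rewrite mulrBl zX -scalerAl mul1r mulrBl -mulrA zw -scalerAr -scalerAl subrr.
by rewrite -!mulrA mulrA -!mulrA (mulrA _ (x ^+ j)) d0 !mulr0.
Qed.

Lemma noncentral_contains_sl L z : w <> 0 -> is_lie_ideal L -> L z ->
  (forall k : K, z <> k *: 1) -> contains_sl L.
Proof.
move=> w0 [sL brL] Lz zk.
have brL' a u : L u -> L (bracket u a).
  by move=> Lu; rewrite bracketC; apply: (subspaceN sL); apply: brL.
have [a az] : exists a, bracket a z <> 0.
  apply: contrapT => H; have [b|k] := center_scalar w0 (z := z); last exact: zk.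
  by apply: contrapT => bz; apply: H; exists b.
have Lg : L (bracket a z) by apply: brL.
have Fg := F_bracket a z; move: (bracket a z) az Lg Fg => g g0 Lg Fg.
have [i [j [k [k0 ek]]]] := nonzero_entry Fg g0.
have [N [Ng gN]] := F_finite Fg.
(* The indices [N] and [N + 1] lie beyond the size of [g], so that only one of
   the two terms of each bracket survives. *)
have L1 : L (E N N.+1).
  have : L (bracket (bracket (E N i) g) (E j N.+1)) by apply/brL'/brL.
  have -> : bracket (E N i) g = E N i * g.
    by rewrite bracketE {2}/E !mulrA gN !mul0r subr0.
  rewrite bracketE [E j _ * _]mulrA mx_unitM.
  rewrite (gtn_eqF (ltnSn N)) mul0r subr0.
  have -> : E N i * g * E j N.+1 = x ^+ N * (w * (y ^+ i * g * x ^+ j) * w) * y ^+ N.+1.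
    by rewrite /E !mulrA.
  rewrite ek -scalerAr -scalerAl => /(subspaceZ k^-1 sL).
  by rewrite scalerA mulVf // scale1r.
set q := N.+1 in L1; have Nq : (N == q) = false by rewrite ltn_eqF.
have Laq l : l != q -> L (E l q).
  move=> aq; have := brL (E l N) _ L1.
  by rewrite bracketE !mx_unitM eqxx (eq_sym q) (negPf aq) subr0.
have Lab l n : l != q -> n != q -> L (E l n - (if n == l then E q q else 0)).
  move=> aq bq; have := brL' (E q n) _ (Laq _ aq).
  by rewrite bracketE !mx_unitM eqxx.
have Ldiag l : L (E l l - E q q).
  have [->|aq] := eqVneq l q; first by rewrite subrr; apply: subspace0.
  by have := Lab _ _ aq aq; rewrite eqxx.
have Lab0 l n : l != n -> l != q -> n != q -> L (E l n).
  by move=> ab aq bq; have := Lab _ _ aq bq; rewrite eq_sym (negPf ab) subr0.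
split=> // [l n ab|l n]; last first.
  by have := subspaceB sL (Ldiag l) (Ldiag n); rewrite opprB addrA subrK.
have [bq|bq] := eqVneq n q; first by rewrite bq in ab *; apply: Laq.
have [->|aq] := eqVneq l q; last exact: Lab0.
(* The row [q] is reached through an index [h] other than [q] and [n]. *)
pose h := (q + n).+1.
have hn : h != n by rewrite gtn_eqF // ltnS leq_addl.
have hq : h != q by rewrite gtn_eqF // ltnS leq_addr.
have := brL (E q h) _ (Lab0 h n hn hq bq).
by rewrite bracketE !mx_unitM eqxx (negPf bq) subr0.
Qed.

(** * Degree zero in the ground field *)

Variables e es : A.
Hypothesis rho_e : rho e = laurent_t K.
Hypothesis rho_es : rho es = laurent_tV K.

Local Notation P := (lspan ([set 1] `|`
  [set a | exists l m : nat, [/\ l \in [pchar K], (1 <= m)%N &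
             a = e ^+ (m * l) \/ a = es ^+ (m * l)]])).

(** Modulo [F], the spanning elements of [P] are monomials whose degree is a
    multiple of the characteristic. *)
Lemma P_s_bracket u : P u -> forall a, s (bracket a u).
Proof.
have slS := s_contains_sl; have sS := s_subspace.
have deg0 b : degree_mod s b 0 -> forall a, s (bracket a b).
  move=> db a; have := db a; rewrite scale0r subr0 => sba.
  by rewrite bracketC; apply: (subspaceN sS).
have degX b c n l m : l \in [pchar K] -> rho b = rho c -> degree_mod s c n ->
    degree_mod s (b ^+ (m * l)) 0.
  move=> pl bc dc; apply: (degree_mod_congr slS (b := c ^+ (m * l))).
    by apply: F_congr; rewrite !rmorphXn /= bc.
  rewrite -(mulr0n n) -[X in n *+ X](muln0 m) .
  have := degree_modX slS (m * l) dc.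
  by rewrite mulrnA -mulr_natr (pcharf0 pl) mulr0 muln0 mulr0n.
move=> Pu a; move: u Pu; apply: (lspan_sub (bracket_preimage_subspace a sS)).
move=> _ [->|[l [m [pl _ []->]]]] /=.
- by rewrite bracketE mulr1 mul1r subrr; apply: subspace0.
- by apply: deg0; apply: (degX _ x 1) pl _ (degree_modx slS); rewrite rho_e rho_x.
- by apply: deg0; apply: (degX _ y (-1)) pl _ (degree_mody slS); rewrite rho_es rho_y.
Qed.

Local Notation Q := (sum_set s (sum_set P (lspan [set w]))).

Lemma Pw_subspace : is_subspace (sum_set P (lspan [set w])).
Proof. by apply: sum_set_subspace; apply: lspan_subspace. Qed.

Lemma sPw_subspace : is_subspace Q.
Proof. by apply: sum_set_subspace; [exact: s_subspace | exact: Pw_subspace]. Qed.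

Lemma F_sub_sPw : F `<=` Q.
Proof.
have [sPw sQ] := (Pw_subspace, sPw_subspace).
apply: F_sub_of_w.
  case: s_contains_sl => _ soff sdiag.
  by split=> // i j => [ij|]; apply: sum_set_l => //; apply: soff.
apply: sum_set_r; first exact: s_subspace.
by apply: sum_set_r; [exact: lspan_subspace | exact: sub_lspan].
Qed.

Lemma monomial_degree0 k m : k%:R - m%:R = 0 :> K ->
  exists2 u, P u & rho (x ^+ k * y ^+ m) = rho u.
Proof.
have chi n : (0 < n)%N -> n%:R = 0 :> K -> exists l m', [/\ l \in [pchar K],
    (1 <= m')%N & n = (m' * l)%N].
  move=> n0 /eqP n0K; have [l pl] := natf0_pchar n0 n0K; exists l.
  have /dvdnP[m' e'] : (l %| n)%N by rewrite (dvdn_pcharf pl).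
  by exists m'; split=> //; case: m' e' n0 => // ->.
have tX n : laurent_t K ^+ n * laurent_tV K ^+ n = 1.
  by rewrite -exprMn laurent_tK expr1n.
move=> /eqP; rewrite subr_eq0 => /eqP km.
rewrite rmorphM !rmorphXn /= rho_x rho_y.
case: (ltngtP m k) => [lt|lt|->]; last first.
- by exists 1; [apply: sub_lspan; left | rewrite tX rmorph1].
- have [||l [n [pl n1 en]]] := chi (m - k)%N; first by rewrite subn_gt0.
    by rewrite natrB 1?ltnW // km subrr.
  exists (es ^+ (n * l)).
    by apply: sub_lspan; right; exists l, n; split=> //; right.
  by rewrite rmorphXn /= rho_es -en -{1}(subnKC (ltnW lt)) exprD mulrA tX mul1r.
- have [||l [n [pl n1 en]]] := chi (k - m)%N; first by rewrite subn_gt0.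
    by rewrite natrB 1?ltnW // km subrr.
  exists (e ^+ (n * l)).
    by apply: sub_lspan; right; exists l, n; split=> //; left.
  by rewrite rmorphXn /= rho_e -en -{1}(subnK (ltnW lt)) exprD -mulrA tX mulr1.
Qed.

(** Only the monomials whose degree vanishes in [K] occur in [z] modulo [F], and
    each of them agrees modulo [F] with an element of [P]. *)
Lemma normalizer_sub_sPw S z :
  contains_sl S -> ~ S w -> (forall a, S (bracket a z)) -> Q z.
Proof.
move=> slS Sw Sz; have [p [m Fz]] := normal_form z.
have p0 := coef_degree0 slS Sw Sz Fz.
have sQ := sPw_subspace.
apply: (subspace_congr sQ) (F_sub_sPw Fz) _.
rewrite horner_alg_sum mulr_suml; apply: (subspace_sum _ sQ) => k.
have /eqP := p0 k; rewrite mulf_eq0 -scalerAl => /orP[/eqP->|/eqP k0].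
  by rewrite scale0r; apply: (subspace0 sQ).
have [u Pu ru] := monomial_degree0 k0.
apply: (subspaceZ _ sQ); apply: (subspace_congr sQ) (F_sub_sPw (F_congr ru)) _.
apply: sum_set_r; first exact: s_subspace.
by apply: sum_set_l => //; apply: lspan_subspace.
Qed.

(** * Classification *)

Theorem jacobson_lie_ideals L :
  is_lie_ideal L <->
  [\/ L = [set 0] \/ L = lspan [set 1],
      exists U : set A, [/\ is_subspace U, U `<=` sum_set P (lspan [set w]),
            ~ U w & L = sum_set s U] |
      exists2 W : set (laurent K), is_subspace W & L = rho @^-1` W].
Proof.
split=> [LL|].
  have [FL|FL] := pselect (F `<=` L).
    apply: Or33; exists (rho @` L).
      case: LL => sL _; apply/is_subspaceP; split.
        by exists 0; [apply: subspace0 | apply: rmorph0].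
      move=> k _ _ [a La <-] [b Lb <-]; exists (k *: a + b); last by rewrite linearP.
      by apply: subspaceD => //; apply: subspaceZ.
    apply/seteqP; split=> [a La|a [b Lb rba]]; first by exists a.
    case: LL => sL _; apply: (subspace_congr sL) (FL _ _) Lb.
    exact: F_congr.
  case: (LL) => sL brL.
  have w0 : w <> 0.
    (* Otherwise [F = 0], which is contained in [L]. *)
    move=> w0; apply: FL; apply: (F_ind sL) => i j.
    by rewrite /E w0 mulr0 mul0r; apply: subspace0.
  have [[z Lz zk]|H] := pselect (exists2 z, L z & forall k : K, z <> k *: 1); last first.
    apply: Or31.
    have {}H z : L z -> exists k : K, z = k *: 1.
      move=> Lz; apply: contrapT => nk; apply: H; exists z => // k zk.
      by apply: nk; exists k.
    have [[z Lz z0]|H0] := pselect (exists2 z, L z & z <> 0).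
      right; apply/seteqP; split=> [u /H[k ->]|u /lspan1P[k ->]].
        by apply/lspan1P; exists k.
      have [c zc] := H z Lz.
      have c0 : c != 0 by apply/eqP => c0; apply: z0; rewrite zc c0 scale0r.
      by rewrite -(mulfVK c0 k) -scalerA -zc; apply: subspaceZ.
    left; apply/seteqP; split=> [u Lu|_ ->]; last exact: subspace0.
    by apply: contrapT => u0; apply: H0; exists u.
  have slL := noncentral_contains_sl w0 LL Lz zk.
  have Lw : ~ L w by move=> /(F_sub_of_w slL) /FL.
  apply: Or32; exists (L `&` sum_set P (lspan [set w])); split.
  - have sPw := Pw_subspace.
    apply/is_subspaceP; split=> [|k a b [La Pa] [Lb Pb]].
      by split; [apply: subspace0 | apply: (subspace0 sPw)].
    split; first by apply: subspaceD => //; apply: subspaceZ.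
    by apply: (subspaceD sPw) => //; apply: (subspaceZ _ sPw).
  - by move=> a [].
  - by case.
  apply/seteqP; split=> [a La|_ [b sb [c [Lc _] <-]]].
    have [b sb [c Pc bc]] := normalizer_sub_sPw slL Lw (fun b => brL b a La).
    exists b => //; exists c => //; split=> //.
    rewrite (_ : c = a - b); last by rewrite -bc addrC addKr.
    by apply: subspaceB => //; apply: s_sub_of_contains_sl sb.
  by apply: subspaceD => //; apply: s_sub_of_contains_sl sb.
have br0 (L' : set A) : L' 0 -> (forall u, L' u -> exists k : K, u = k *: 1) ->
    forall a u, L' u -> L' (bracket a u).
  move=> L0 Lk a u /Lk[k ->].
  by rewrite bracketZr bracketE mulr1 mul1r subrr scaler0.
case=> [[]->|[U [sU UPw Uw ->]]|[W sW ->]].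
- split; last by apply: br0 => // _ ->; exists 0; rewrite scale0r.
  by apply/is_subspaceP; split=> // k _ _ -> ->; rewrite /= scaler0 addr0.
- split; first exact: lspan_subspace.
  by apply: br0 => [|u /lspan1P]; [exact: subspace0 (lspan_subspace _) |].
- split; first by apply: sum_set_subspace => //; apply: s_subspace.
  move=> a _ [b sb [u Uu <-]]; apply: sum_set_l => //.
  rewrite bracketDr; apply: (subspaceD s_subspace).
    exact: contains_sl_bracketF s_contains_sl _ _ (s_sub_F sb).
  have [v Pv [_ /lspan1P[k ->] <-]] := UPw u Uu.
  rewrite bracketDr bracketZr; apply: (subspaceD s_subspace); first exact: P_s_bracket.
  apply: (subspaceZ _ s_subspace); apply: (contains_sl_bracketF s_contains_sl).
  exact: sub_gen_smallest.
split.
  apply/is_subspaceP; split=> [|k a b /= Wa Wb].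
    by rewrite /= rmorph0; apply: subspace0.
  by rewrite linearP; apply: subspaceD => //; apply: subspaceZ.
move=> a u /= Wu; rewrite bracketE rmorphB !rmorphM mulrC subrr.
exact: subspace0.
Qed.

End JacobsonAlgebra.

(** * The Toeplitz algebra as a Jacobson algebra *)
Section ToeplitzFamily.
Variables (K : fieldType) (B : algType K) (g : toeplitz_gen -> B).
Hypothesis gP : toeplitz_family g.
Let x := g Gen_e + g Gen_f.
Let y := g Gen_es + g Gen_fs.

Let rel a b : (a, b) \in toeplitz_relations g -> a = b.
Proof. exact: gP. Qed.

Let one_vw : 1 = g Gen_v + g Gen_w.
Proof. by apply: rel; rewrite !inE eqxx ?orbT. Qed.
Let vw : g Gen_v * g Gen_w = 0.
Proof. by apply: rel; rewrite !inE eqxx ?orbT. Qed.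
Let ev : g Gen_e * g Gen_v = g Gen_e.
Proof. by apply: rel; rewrite !inE eqxx ?orbT. Qed.
Let fw : g Gen_f * g Gen_w = g Gen_f.
Proof. by apply: rel; rewrite !inE eqxx ?orbT. Qed.
Let ves : g Gen_v * g Gen_es = g Gen_es.
Proof. by apply: rel; rewrite !inE eqxx ?orbT. Qed.
Let wfs : g Gen_w * g Gen_fs = g Gen_fs.
Proof. by apply: rel; rewrite !inE eqxx ?orbT. Qed.
Let ese : g Gen_es * g Gen_e = g Gen_v.
Proof. by apply: rel; rewrite !inE eqxx ?orbT. Qed.
Let fsf : g Gen_fs * g Gen_f = g Gen_w.
Proof. by apply: rel; rewrite !inE eqxx ?orbT. Qed.
Let esf : g Gen_es * g Gen_f = 0.
Proof. by apply: rel; rewrite !inE eqxx ?orbT. Qed.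
Let fse : g Gen_fs * g Gen_e = 0.
Proof. by apply: rel; rewrite !inE eqxx ?orbT. Qed.
Let v_sum : g Gen_v = g Gen_e * g Gen_es + g Gen_f * g Gen_fs.
Proof. by apply: rel; rewrite !inE eqxx ?orbT. Qed.
Let wv : g Gen_w * g Gen_v = 0.
Proof. by apply: rel; rewrite !inE eqxx ?orbT. Qed.

Lemma toeplitz_family_yx : y * x = 1.
Proof.
by rewrite mulrDl !mulrDr ese esf fse fsf addr0 add0r -one_vw.
Qed.

Let ew : g Gen_e * g Gen_w = 0. Proof. by rewrite -ev -mulrA vw mulr0. Qed.
Let fv : g Gen_f * g Gen_v = 0. Proof. by rewrite -fw -mulrA wv mulr0. Qed.
Let wes : g Gen_w * g Gen_es = 0. Proof. by rewrite -ves mulrA wv mul0r. Qed.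
Let vfs : g Gen_v * g Gen_fs = 0. Proof. by rewrite -wfs mulrA vw mul0r. Qed.

Let xyv : x * y = g Gen_v.
Proof.
rewrite mulrDl !mulrDr v_sum.
have -> : g Gen_e * g Gen_fs = 0 by rewrite -wfs mulrA ew mul0r.
have -> : g Gen_f * g Gen_es = 0 by rewrite -ves mulrA fv mul0r.
by rewrite addr0 add0r.
Qed.

Lemma toeplitz_family_xy : x * y = 1 - g Gen_w.
Proof. by rewrite xyv one_vw addrK. Qed.

Lemma toeplitz_family_genE i : g i =
  match i with
  | Gen_v => x * y
  | Gen_w => 1 - x * y
  | Gen_e => x * (x * y)
  | Gen_f => x * (1 - x * y)
  | Gen_es => x * y * y
  | Gen_fs => (1 - x * y) * y
  end.
Proof.
have xy_w : 1 - x * y = g Gen_w by rewrite xyv one_vw addrC addKr.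
case: i; rewrite ?xy_w ?xyv //.
- by rewrite mulrDl ev fv addr0.
- by rewrite mulrDl ew fw add0r.
- by rewrite mulrDr ves vfs addr0.
- by rewrite mulrDr wes wfs add0r.
Qed.

Lemma toeplitz_family_closed (S : set B) : is_subspace S ->
  (forall a, S a -> S (x * a) /\ S (y * a)) -> forall i a, S a -> S (g i * a).
Proof.
move=> sS Sxy i a Sa.
have Sx b : S b -> S (x * b) by case/Sxy.
have Sy b : S b -> S (y * b) by case/Sxy.
have Sw b : S b -> S ((1 - x * y) * b).
  move=> Sb; rewrite mulrBl mul1r; apply: (subspaceB sS) => //.
  by rewrite -mulrA; apply/Sx/Sy.
rewrite toeplitz_family_genE; case: i.
- by rewrite -mulrA; apply/Sx/Sy.
- exact: Sw.
- by rewrite -!mulrA; apply/Sx/Sx/Sy.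
- by rewrite -mulrA; apply/Sx/Sw.
- by rewrite -!mulrA; apply/Sx/Sy/Sy.
- by rewrite -mulrA; apply/Sw/Sy.
Qed.

End ToeplitzFamily.

Section Toeplitz.
Variable K : fieldType.
Local Notation T := (toeplitz K).

Lemma toeplitz_pi_monom (m : seq toeplitz_gen) :
  toeplitz_pi (mkmalgU (FMonom m) 1) = \prod_(i <- m) gen K i.
Proof.
elim: m => [|i m IH].
  rewrite big_nil -[RHS](rmorph1 (@toeplitz_pi K)); congr toeplitz_pi.
  by rewrite -fmoneE.
rewrite big_cons -IH /gen -rmorphM; congr toeplitz_pi.
rewrite /free_gen malgM_def fgmulUU mulr1; congr mkmalgU.
by rewrite fmuE; apply/esym/fmmulE.
Qed.

(** The monomials in the generators span the free algebra, hence its quotient. *)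
Lemma toeplitz_gen_ind (S : set T) : is_subspace S -> S 1 ->
  (forall i a, S a -> S (gen K i * a)) -> forall a, S a.
Proof.
move=> sS S1 Sg; elim/toeplitz_ind => u.
rewrite [u]monalgE raddf_sum; apply: (subspace_sum _ sS) => m.
have -> : mkmalgU m (mcoeff m u) =
    mcoeff m u *: (mkmalgU m 1 : free_alg K).
  by apply/malgP => k; rewrite mcoeffZ !mcoeffU mulrnAr mulr1.
rewrite /= linearZ.
apply: (subspaceZ _ sS); case: m => m.
rewrite /= toeplitz_pi_monom; elim: m => [|i m IH]; first by rewrite big_nil.
by rewrite big_cons; apply: Sg.
Qed.

Let x : T := gen K Gen_e + gen K Gen_f.
Let y : T := gen K Gen_es + gen K Gen_fs.

Lemma toeplitz_xy_ind (S : set T) : is_subspace S -> S 1 ->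
  (forall a, S a -> S (x * a) /\ S (y * a)) -> forall a, S a.
Proof.
have gP : toeplitz_family (gen K) := @toeplitz_family_pi K.
by move=> sS S1 Sxy; apply: toeplitz_gen_ind (toeplitz_family_closed gP sS Sxy).
Qed.

End Toeplitz.

Theorem theorem4p9 (K : fieldType) (L : set (toeplitz K)) :
  is_lie_ideal L <->
  [\/ L = [set 0] \/ L = lspan [set 1],
      exists U : set (toeplitz K),
        [/\ is_subspace U,
            U `<=` sum_set (P_space K) (lspan [set gen K Gen_w]),
            ~ U (gen K Gen_w) &
            L = sum_set (s_ideal K) U] |
      exists2 W : set (laurent K), is_subspace W & L = rho (K := K) @^-1` W].
Proof.
have gP : toeplitz_family (gen K) := @toeplitz_family_pi K.
apply: (@jacobson_lie_ideals K (toeplitz K) (gen K Gen_e + gen K Gen_f)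
  (gen K Gen_es + gen K Gen_fs) (gen K Gen_w) (toeplitz_family_yx gP)
  (toeplitz_family_xy gP) (@toeplitz_xy_ind K) (rho (K := K)) _ _
  (gen K Gen_e) (gen K Gen_es)).
- by rewrite rmorphD /= !rho_gen /= addr0.
- by rewrite rmorphD /= !rho_gen /= addr0.
- exact: rho_gen.
- exact: rho_gen.
Qed.
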